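(* For every odd integer $t\geqslant7$, the effective exponents of the normal form orbit of order $t$ satisfy $\kappa(N_t+2)=2$.
   Context: Normal form orbit of order $t$ ($t\geqslant5$ odd): set $\gamma_{t-1}:=[0,1]$, $\mathcal{M}_{t-2}:=0$, $\mathcal{M}_{t-1}:=\frac12$, and for every $n\geqslant t$ let $y_n=n\mathcal{M}_{n-1}-(n-1)\mathcal{M}_{n-2}$, $\gamma_n=\gamma_{n-1}\uplus[y_n]$ (multiset union), and $\mathcal{M}_n:=\mathcal{M}(\gamma_n)$, the median of $\gamma_n$ (the average of the two central elements if $|\gamma_n|$ is even). All $y_n$ are dyadic rationals. For $n\geqslant t$, the $n$-th effective exponent $\kappa(n)$ is the maximum of the $2$-adic valuations of the denominators, in lowest terms, of $y_t,\ldots,y_n$. With $u_\ell:=\ell+1+\sqrt{5\ell^2+6\ell+5}$ for $\ell\in\mathbb{N}_0$, define $L_t:=\max\{\ell\in\mathbb{N}_0:t>u_\ell\}$ and $N_t:=t+4L_t+3$. *)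

(* Defs.v *)
From HB Require Import structures.
From mathcomp Require Import all_boot all_order all_algebra.

Set Implicit Arguments.
Unset Strict Implicit.
Unset Printing Implicit Defensive.

Import Order.TTheory GRing.Theory Num.Theory.
Local Open Scope ring_scope.

(* Finite multisets of rationals are represented by sequences, in no particular
   order; [median] sorts its argument, so it only depends on the multiset. *)
Definition median (g : seq rat) : rat :=
  let s := sort <=%R g in
  if odd (size s) then s`_(size s)./2
  else (s`_(size s)./2.-1 + s`_(size s)./2) / 2.

Lemma perm_median (g h : seq rat) : perm_eq g h -> median g = median h.
Proof. by move/perm_sort_leP; rewrite /median => ->. Qed.

(* [orbit_state t k] is the pair (gamma_(t-1+k), M_(t-2+k)); the step from k to
   k.+1 adds y_(t+k) to the multiset. *)
Fixpoint orbit_state (t k : nat) : seq rat * rat :=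
  if k is j.+1 then
    let: (g, m) := orbit_state t j in
    let n := (t + j)%N in
    (rcons g (n%:R * median g - n.-1%:R * m), median g)
  else ([:: 0; 1], 0).

(* The orbit of order t, with the absolute indexing: the definitions below are
   meaningful for n >= t - 1, n >= t - 2 and n >= t respectively, with t >= 2. *)
Definition orbit_gamma (t n : nat) : seq rat := (orbit_state t (n.+1 - t)).1.

Definition orbit_median (t n : nat) : rat :=
  if (n < t.-1)%N then 0 else median (orbit_gamma t n).

Definition orbit_y (t n : nat) : rat :=
  n%:R * orbit_median t n.-1 - n.-1%:R * orbit_median t n.-2.

Lemma orbit_gamma_init (t : nat) : (2 <= t)%N ->
  orbit_gamma t t.-1 = [:: 0; 1].
Proof. by case: t => // t _; rewrite /orbit_gamma /= subnn. Qed.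

Lemma orbit_median_init2 (t : nat) : (2 <= t)%N -> orbit_median t t.-2 = 0.
Proof. by case: t => [|[|t]] //= _; rewrite /orbit_median /= ltnSn. Qed.

Lemma orbit_median_init1 (t : nat) : (2 <= t)%N -> orbit_median t t.-1 = 1 / 2.
Proof.
by move=> t2; rewrite /orbit_median ltnn orbit_gamma_init //; apply/eqP.
Qed.

Lemma orbit_gammaS (t n : nat) : (2 <= t)%N -> (t <= n)%N ->
  orbit_gamma t n = rcons (orbit_gamma t n.-1) (orbit_y t n).
Proof.
case: t => // t t2 /subnKC <-; move: (n - t.+1)%N => {n} j.
have gam i : orbit_gamma t.+1 (t + i) = (orbit_state t.+1 i).1.
  by rewrite /orbit_gamma subSS addKn.
have med i : orbit_median t.+1 (t + i) = median (orbit_state t.+1 i).1.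
  by rewrite /orbit_median /= ltnNge leq_addr /= gam.
have state2 : (orbit_state t.+1 j).2 = orbit_median t.+1 (t + j).-1.
  case: j => [|j]; first by rewrite addn0 (orbit_median_init2 t2).
  by rewrite addnS /= med; case: (orbit_state t.+1 j).
rewrite addSn -addnS gam addnS /orbit_y /= gam med -state2.
by case: (orbit_state t.+1 j).
Qed.

Lemma orbit_medianE (t n : nat) : (t.-1 <= n)%N ->
  orbit_median t n = median (orbit_gamma t n).
Proof. by rewrite /orbit_median ltnNge => ->. Qed.

Definition effective_exponent (t n : nat) : nat :=
  \max_(t <= i < n.+1) logn 2 `|denq (orbit_y t i)|%N.

(* Any real closed field, in particular the reals, can host the square roots:
   the comparisons below, hence [L] and [N], do not depend on the choice. *)
Definition u (R : rcfType) (l : nat) : R :=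
  l%:R + 1 + Num.sqrt (5 * l%:R ^+ 2 + 6 * l%:R + 5).

(* The bound l < t loses nothing, since l < u l; see [L_max]. *)
Definition L (R : rcfType) (t : nat) : nat := \max_(l < t | u R l < t%:R) l.

Lemma L_max (R : rcfType) (t : nat) : (5 <= t)%N ->
  u R (L R t) < t%:R /\ (forall l : nat, u R l < t%:R -> (l <= L R t)%N).
Proof.
move=> t5; have t0 : (0 < t)%N by apply: leq_trans t5.
have u0 : u R 0 < t%:R.
  apply: (@lt_le_trans _ _ 5%:R); last by rewrite ler_nat.
  rewrite /u expr0n /= !mulr0 !add0r [ltRHS](natrD R 1 4) ltrD2l.
  rewrite -(@ltr_pXn2r _ 2) ?nnegrE ?sqrtr_ge0 ?ler0n // sqr_sqrtr ?ler0n //.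
  by rewrite -natrX ltr_nat.
split.
  rewrite /L; elim/big_ind: _ => // m n um un.
  by rewrite /maxn; case: ifP.
move=> l ul; have lt_lt : (l < t)%N.
  rewrite -(ltr_nat R); apply: le_lt_trans ul.
  by rewrite /u -addrA lerDl addr_ge0 ?sqrtr_ge0.
exact: (@leq_bigmax_cond _ _ (fun i : 'I_t => nat_of_ord i) (Ordinal lt_lt)).
Qed.

Definition N (R : rcfType) (t : nat) : nat := (t + 4 * L R t + 3)%N.

(* Main.v *)
Require Import Defs.
From mathcomp Require Import all_boot all_order all_algebra.
From mathcomp Require Import zify ring lra.

Set Implicit Arguments.
Unset Strict Implicit.
Unset Printing Implicit Defensive.

Import Order.TTheory GRing.Theory Num.Theory.
Local Open Scope ring_scope.

(** As long as the orbit grows regularly, it can be computed in closed form by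
blocks of four steps. The l-th block produces
    y_(t+4l) = low (l+1),      y_(t+4l+1) = low (l+1) + 1,
    y_(t+4l+2) = high l,       y_(t+4l+3) = high l + gap l,
where low l = l(t+2l-2)/2 is half an integer and high l lies in (1/4)Z, with
high 0 = t^2/4. Counting the two initial points as low 0 = 0 and
low 0 + 1 = 1, the multiset before the l-th block consists of the 2(l+1) small
values low j, low j + 1 (j <= l) and of the 2l large values high j,
high j + gap j (j < l). Since high 0 is the least of the large values, the
large values lie above the small ones as soon as low l + 1 <= t^2/4; then the
two central elements are low l and low l + 1. If moreover
low (l+1) + 1 <= t^2/4, then the centre moves through low l + 1 and low (l+1)
to low (l+1) + 1 during the block, all its medians can be read off
([median_odd], [median_even]), and the formulas for the y_n follow by algebra
([block_start_second], [block_second_start]).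

The regular regime is the one described by L_t: the inequality
low (l+1) + 1 <= t^2/4 is equivalent to 5l^2+6l+5 <= (t-(l+1))^2, that is, to
u_l <= t when t >= l+1 ([low_le_of_u]). So blocks 0, ..., L_t are regular. Block L_t ends at
n = t + 4 L_t + 3 = N_t, and the first two values of the next block depend only
on medians already known, which takes the formulas up to N_t + 2. All the y_n
up to there lie in (1/4)Z ([orbit_y_quarter_int]), so no exponent exceeds 2,
and y_(t+2) = t^2/4 with t odd has exponent exactly 2. *)

(** * Medians of split multisets *)

Lemma sort_cat_le (p q : seq rat) : {in p & q, forall a b, a <= b} ->
  sort <=%R (p ++ q) = sort <=%R p ++ sort <=%R q.
Proof.
move=> le_pq; apply: (sorted_eq le_trans le_anti).
- exact: sort_le_sorted.
- have sortedE s : sorted <=%R s = pairwise <=%R s.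
    exact/sorted_pairwise/le_trans.
  rewrite sortedE pairwise_cat -!sortedE !sort_le_sorted !andbT.
  by apply/allrelP=> a b; rewrite !mem_sort; apply: le_pq.
- by rewrite perm_sort perm_sym perm_cat // perm_sort.
Qed.

(** Only the position of the other elements relative to the centre matters: the
two outer parts may come in any order, so a multiset that is known up to
permutation needs no full sorting. *)
Lemma median_odd (g p q : seq rat) (x : rat) :
    perm_eq g (p ++ x :: q) -> size p = size q ->
    all (<= x) p -> all (>= x) q -> median g = x.
Proof.
move=> /perm_median -> eq_size /allP p_le /allP q_ge.
have le_x1 : {in [:: x] & q, forall a b, a <= b}.
  by move=> a b /[!inE] /eqP -> /q_ge.
rewrite /median sort_cat_le => [|a b /p_le a_le]; last first.
  by rewrite inE => /predU1P[-> //|/q_ge]; apply: le_trans.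
rewrite -[x :: q]cat1s sort_cat_le // !size_cat !size_sort eq_size /=.
have -> : (size q + (1 + size q) = (size q).*2.+1)%N by lia.
by rewrite /= odd_double uphalf_double /= nth_cat size_sort eq_size ltnn subnn.
Qed.

Lemma median_even (g p q : seq rat) (x y : rat) :
    perm_eq g (p ++ [:: x, y & q]) -> size p = size q -> x <= y ->
    all (<= x) p -> all (>= y) q -> median g = (x + y) / 2.
Proof.
move=> /perm_median -> eq_size le_xy /allP p_le /allP q_ge.
have le_y1 : {in [:: y] & q, forall a b, a <= b}.
  by move=> a b /[!inE] /eqP -> /q_ge.
have le_x1 : {in [:: x] & y :: q, forall a b, a <= b}.
  move=> a b /[!inE] /eqP -> /predU1P[-> //|/q_ge]; exact: le_trans.
rewrite /median sort_cat_le => [|a b /p_le a_le]; last first.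
  rewrite inE => /predU1P[-> //|b_in]; apply: le_trans a_le _.
  by apply: le_x1; rewrite ?inE.
rewrite -[x :: _]cat1s -[y :: q]cat1s sort_cat_le // sort_cat_le //.
rewrite !size_cat !size_sort eq_size /=.
have -> : (size q + (1 + (1 + size q)) = (size q).+1.*2)%N by lia.
rewrite odd_double doubleK /= !nth_cat size_sort eq_size ltnn subnn /=.
by rewrite ltnNge leqnSn subSnn.
Qed.

(** * Stepping along the orbit *)

Lemma perm_insert (T : eqType) (x : T) (g p r q : seq T) :
  perm_eq g (p ++ r ++ q) -> perm_eq (x :: g) (p ++ r ++ x :: q).
Proof.
rewrite !catA => perm_g.
by rewrite -[x :: q]cat1s perm_sym perm_catCA /= perm_cons perm_sym.
Qed.

(** The situation just before y_(t+k) is added: the current multiset, up to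
order, followed by the previous and the current median. Counting from t makes
k = 0 the initial situation. *)
Definition orbit_at (t k : nat) (g : seq rat) (z x : rat) : Prop :=
  [/\ perm_eq (orbit_gamma t (t + k).-1) g,
      orbit_median t (t + k).-2 = z & orbit_median t (t + k).-1 = x].

Section Orbit.

Variable t : nat.
Hypothesis t_ge2 : (2 <= t)%N.

Lemma orbit_at0 : orbit_at t 0 [:: 0; 1] 0 (1 / 2).
Proof.
rewrite /orbit_at addn0 orbit_gamma_init //.
by rewrite orbit_median_init2 ?orbit_median_init1.
Qed.

Lemma orbit_at_y (k : nat) (g : seq rat) (z x : rat) :
  orbit_at t k g z x ->
  orbit_y t (t + k) = (t%:R + k%:R) * x - (t%:R + k%:R - 1) * z.
Proof.
case=> _ <- <-; rewrite /orbit_y.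
have -> : (t + k).-1%:R = t%:R + k%:R - 1 :> rat.
  by rewrite -subn1 natrB ?natrD //; lia.
by rewrite natrD.
Qed.

Lemma orbit_atS (k : nat) (g : seq rat) (z x y m : rat) :
  orbit_at t k g z x -> orbit_y t (t + k) = y -> median (y :: g) = m ->
  orbit_at t k.+1 (y :: g) x m.
Proof.
move=> [perm_g _ x_def] y_def m_def.
have gE : perm_eq (orbit_gamma t (t + k)) (y :: g).
  by rewrite orbit_gammaS ?leq_addr // y_def perm_rcons perm_cons.
split; rewrite addnS //=.
by rewrite orbit_medianE ?(perm_median gE) //; lia.
Qed.

(** * Closed forms in the regular regime *)

(** The closed forms, found as follows. If the medians before the l-th block are
low l and low l + 1/2, then the recurrence at n = t + 4l adds
low l + (t + 4l)/2, which must be low (l+1); this sums to the formula below. *)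
Definition low (l : nat) : rat := l%:R * (t%:R + 2 * l%:R - 2) / 2.

Definition high (l : nat) : rat :=
  (t%:R + 4 * l%:R + 2) * (t%:R + 4 * l%:R - 2) / 4 + low l + 1.

(** Both the distance from low l + 1 to low (l+1) and the distance between the
two large values of the l-th block. *)
Definition gap (l : nat) : rat := (t%:R + 4 * l%:R - 2) / 2.

Fixpoint lows (l : nat) : seq rat :=
  if l is j.+1 then lows j ++ [:: low j; low j + 1] else [::].

Fixpoint highs (l : nat) : seq rat :=
  if l is j.+1 then [:: high j + gap j, high j & highs j] else [::].

Lemma size_lows (l : nat) : size (lows l) = (2 * l)%N.
Proof. by elim: l => //= l IH; rewrite size_cat IH /=; lia. Qed.

Lemma size_highs (l : nat) : size (highs l) = (2 * l)%N.
Proof. by elim: l => //= l ->; lia. Qed.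

Let t_ge2R : 2 <= t%:R :> rat. Proof. by rewrite ler_nat. Qed.

Lemma gap_ge0 (l : nat) : 0 <= gap l.
Proof. by rewrite /gap; have := ler0n rat l; have := t_ge2R; lra. Qed.

Lemma lowS (l : nat) : low l.+1 = low l + 1 + gap l.
Proof. by rewrite /low /gap -natr1; field. Qed.

Lemma lows_le (l : nat) : all (<= low l) (lows l).
Proof.
elim: l => //= l /allP IH; rewrite lowS; have := gap_ge0 l => gap_ge.
rewrite all_cat /= andbT; apply/and3P; split; [|lra..].
by apply/allP=> a /IH /=; lra.
Qed.

Lemma high0 : high 0 = t%:R ^+ 2 / 4.
Proof. by rewrite /high /low; field. Qed.

(** The first large value is the least one, which makes a single comparison with
t^2/4 enough to separate the small values from the large ones. *)
Lemma high_ge (l : nat) : t%:R ^+ 2 / 4 <= high l.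
Proof.
have l_ge0 := ler0n rat l; have t_ge := t_ge2R.
have -> : high l = t%:R ^+ 2 / 4 +
    (8 * l%:R * t%:R + 16 * l%:R ^+ 2 + 2 * l%:R * (t%:R - 2)
     + 4 * l%:R ^+ 2) / 4.
  by rewrite /high /low; field.
rewrite lerDl; nra.
Qed.

Lemma highs_ge (l : nat) (b : rat) : b <= t%:R ^+ 2 / 4 -> all (>= b) (highs l).
Proof.
move=> le_b; elim: l => //= l IH; rewrite IH andbT.
by have := high_ge l; have := gap_ge0 l => ? ?; apply/andP; split; lra.
Qed.

(** The list splits as 2l small values, the two central ones and 2l large values,
so this is the form that [median_even] needs once the large values dominate. *)
Definition block_start (l : nat) : Prop := exists2 g,
  orbit_at t (4 * l) g (low l) (low l + 1 / 2) &
  perm_eq g (lows l ++ [:: low l, low l + 1 & highs l]).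

(** After y_(t+4l) is added, low l + 1 alone is central. This intermediate stage
is separated out because it is reached under a weaker inequality than the end
of the block. *)
Definition block_second (l : nat) : Prop := exists2 g,
  orbit_at t (4 * l).+1 g (low l + 1 / 2) (low l + 1) &
  perm_eq g (lows l ++ [:: low l, low l + 1, low l.+1 & highs l]).

Lemma block_start0 : block_start 0.
Proof.
exists [:: 0; 1]; last by rewrite /low /= !mul0r add0r.
by have := orbit_at0; rewrite /low !mul0r add0r.
Qed.

Lemma block_start_y (l : nat) :
  block_start l -> orbit_y t (t + 4 * l) = low l.+1.
Proof.
by case=> g /orbit_at_y -> _; rewrite lowS /gap natrM; field.
Qed.

Lemma block_second_y (l : nat) :
  block_second l -> orbit_y t (t + (4 * l).+1) = low l.+1 + 1.
Proof.
by case=> g /orbit_at_y -> _; rewrite lowS /gap -natr1 natrM; field.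
Qed.

(** The new value low (l+1) lies to the right of the centre low l + 1, whether
or not it lies below the large values; hence only low l + 1 is compared with
t^2/4. *)
Lemma block_start_second (l : nat) : low l + 1 <= t%:R ^+ 2 / 4 ->
  block_start l -> block_second l.
Proof.
move=> le_high start; have [g at_g perm_g] := start.
have perm2 : perm_eq (low l.+1 :: g)
               (lows l ++ [:: low l, low l + 1, low l.+1 & highs l]).
  exact: (perm_insert _ (r := [:: low l; low l + 1])).
exists (low l.+1 :: g) => //.
apply: orbit_atS at_g (block_start_y start) _.
apply: (@median_odd _ (rcons (lows l) (low l)) (low l.+1 :: highs l)).
- by rewrite cat_rcons.
- by rewrite size_rcons /= size_lows size_highs.
- rewrite all_rcons; apply/andP; split; first by rewrite /=; lra.
  by apply/allP=> a /(allP (lows_le l)) /=; lra.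
- by rewrite /= highs_ge // andbT lowS; have := gap_ge0 l; lra.
Qed.

(** The values low (l+1) and low (l+1) + 1 become central in turn, one half step
for each added element, provided that they precede all the large values. *)
Lemma block_second_start (l : nat) : low l.+1 + 1 <= t%:R ^+ 2 / 4 ->
  block_second l ->
  [/\ orbit_y t (t + (4 * l).+2) = high l,
      orbit_y t (t + (4 * l).+3) = high l + gap l & block_start l.+1].
Proof.
move=> le_high second; have [g at1 perm1] := second.
have gap_ge := gap_ge0 l; have low_eq := lowS l.
have high_ge := high_ge l.
have lowsl_le : all (<= (low l + 1)) (rcons (lows l) (low l)).
  rewrite all_rcons; apply/andP; split; first by rewrite /=; lra.
  by apply/allP=> a /(allP (lows_le l)) /=; lra.
have lowsS_le := lows_le l.+1.
pose y2 := low l.+1 + 1.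
have perm2 : perm_eq (y2 :: g) (rcons (lows l) (low l) ++
               [:: low l + 1, low l.+1, y2 & highs l]).
  rewrite cat_rcons.
  exact: (perm_insert _ (r := [:: low l; low l + 1; low l.+1])).
have at2 : orbit_at t (4 * l).+2 (y2 :: g) (low l + 1)
             ((low l + 1 + low l.+1) / 2).
  apply: orbit_atS at1 (block_second_y second) _.
  apply: median_even perm2 _ _ _ _ => //; last 1 first.
  - by rewrite /= highs_ge ?andbT /y2; lra.
  - by rewrite size_rcons /= size_lows size_highs.
  - by lra.
have y3E : orbit_y t (t + (4 * l).+2) = high l.
  rewrite (orbit_at_y at2) /high lowS /gap -!natr1 natrM.
  by rewrite /low; field.
have perm3 : perm_eq (high l :: y2 :: g)
    (lows l.+1 ++ [:: low l.+1, y2, high l & highs l]).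
  rewrite /= -catA; move: perm2; rewrite cat_rcons.
  exact: (perm_insert _ (r := [:: low l; low l + 1; low l.+1; y2])).
have at3 : orbit_at t (4 * l).+3 (high l :: y2 :: g)
             ((low l + 1 + low l.+1) / 2) (low l.+1).
  apply: orbit_atS at2 y3E _.
  apply: median_odd perm3 _ lowsS_le _.
  - by rewrite size_lows /= size_highs; lia.
  - by rewrite /= highs_ge /y2 ?andbT; [apply/andP; split; lra | lra].
have y4E : orbit_y t (t + (4 * l).+3) = high l + gap l.
  rewrite (orbit_at_y at3) /high lowS /gap -!natr1 natrM.
  by rewrite /low; field.
have perm4 : perm_eq (high l + gap l :: high l :: y2 :: g)
    (lows l.+1 ++ [:: low l.+1, y2 & highs l.+1]).
  exact: (perm_insert _ (r := [:: low l.+1; y2])).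
split=> //; exists (high l + gap l :: high l :: y2 :: g) => //.
rewrite mulnSr addn4.
apply: orbit_atS at3 y4E _.
rewrite (median_even perm4) //.
- by rewrite /y2; field.
- by rewrite size_lows size_highs.
- by rewrite /y2; lra.
- exact: highs_ge.
Qed.

Lemma block_startP (l : nat) : low l + 1 <= t%:R ^+ 2 / 4 -> block_start l.
Proof.
elim: l => [|l IH] le_high; first exact: block_start0.
have le_high' : low l + 1 <= t%:R ^+ 2 / 4.
  by have := lowS l; have := gap_ge0 l; lra.
by case: (block_second_start le_high
            (block_start_second le_high' (IH le_high'))).
Qed.

Lemma low_mono (l m : nat) : (l <= m)%N -> low l <= low m.
Proof.
elim: m => [|m IH]; first by rewrite leqn0 => /eqP ->.
rewrite leq_eqVlt => /predU1P[-> //|/IH]; rewrite lowS.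
by have := gap_ge0 m; lra.
Qed.

(** * Denominators *)

Lemma low_quarter_int (l : nat) : 4 * low l \is a Num.int.
Proof.
have -> : 4 * low l = 2 * l%:R * (t%:R + 2 * l%:R - 2) by rewrite /low; field.
by rewrite !(rpredB, rpredD, rpredM, rpred_nat).
Qed.

Lemma high_quarter_int (l : nat) : 4 * high l \is a Num.int.
Proof.
have -> : 4 * high l = (t%:R + 4 * l%:R + 2) * (t%:R + 4 * l%:R - 2) +
                        4 * low l + 4 by rewrite /high; field.
rewrite !rpredD ?low_quarter_int ?rpred_nat //.
by rewrite !(rpredB, rpredD, rpredM, rpred_nat).
Qed.

Lemma gap_quarter_int (l : nat) : 4 * gap l \is a Num.int.
Proof.
have -> : 4 * gap l = 2 * (t%:R + 4 * l%:R - 2) by rewrite /gap; field.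
by rewrite !(rpredB, rpredD, rpredM, rpred_nat).
Qed.

(** The range of k goes two steps past the last block covered by the inequality:
the first two values of the l-th block need only low l + 1 <= t^2/4. *)
Lemma orbit_y_quarter_int (l k : nat) :
  low l + 1 <= t%:R ^+ 2 / 4 -> (k <= 4 * l + 1)%N ->
  4 * orbit_y t (t + k) \is a Num.int.
Proof.
move=> le_high le_k; pose j := (k %/ 4)%N.
have le_jl : (j <= l)%N by rewrite /j; lia.
have le_high_j : low j + 1 <= t%:R ^+ 2 / 4 by have := low_mono le_jl; lra.
have start := block_startP le_high_j.
have second := block_start_second le_high_j start.
have [k0|[k1|[lt_jl k23]]] : (k = 4 * j \/ k = (4 * j).+1 \/
    j < l /\ (k = (4 * j).+2 \/ k = (4 * j).+3))%N by rewrite /j; lia.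
- by rewrite k0 block_start_y // low_quarter_int.
- rewrite k1 block_second_y // mulrDr.
  by rewrite rpredD ?low_quarter_int ?rpredM ?rpred_nat.
have le_highS : low j.+1 + 1 <= t%:R ^+ 2 / 4.
  by have := low_mono lt_jl; lra.
have [y2 y3 _] := block_second_start le_highS second.
case: k23 => ->; first by rewrite y2 high_quarter_int.
by rewrite y3 mulrDr rpredD ?high_quarter_int ?gap_quarter_int.
Qed.

Lemma orbit_y_t2 : low 1 + 1 <= t%:R ^+ 2 / 4 ->
  orbit_y t (t + 2) = t%:R ^+ 2 / 4.
Proof.
move=> le_high.
have le_high0 : low 0 + 1 <= t%:R ^+ 2 / 4.
  by have := low_mono (leqnSn 0); lra.
have second := block_start_second le_high0 block_start0.
by have [-> _ _] := block_second_start le_high second; rewrite high0.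
Qed.

End Orbit.

(** After multiplication by 4, the conclusion reads
2(l+1)(t+2l) + 4 <= t^2, which is 5l^2+6l+5 <= (t-(l+1))^2. As it is an
inequality between natural numbers, it can be carried from R to rat. *)
Lemma low_le_of_u (R : rcfType) (t l : nat) : u R l < t%:R ->
  low t l.+1 + 1 <= t%:R ^+ 2 / 4.
Proof.
rewrite /u => lt_t.
set s := 5 * l%:R ^+ 2 + 6 * l%:R + 5 in lt_t.
have l_ge0 := ler0n R l.
have s_ge0 : 0 <= s by rewrite /s; nra.
have sqrt_ge0 := sqrtr_ge0 s; have sqrt_sqr := sqr_sqrtr s_ge0.
have lt_sqr : s < (t%:R - (l%:R + 1)) ^+ 2.
  by rewrite -sqrt_sqr ltr_pXn2r ?nnegrE //; lra.
have : (2 * l.+1 * (t + 2 * l) + 4)%:R < (t ^ 2)%:R :> R.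
  rewrite natrX natrD !natrM -[l.+1%:R]natr1 natrD natrM.
  by move: lt_sqr; rewrite /s; lra.
(* The same inequality of natural numbers, now read in rat. *)
rewrite ltr_nat -(ltr_nat rat) natrX natrD !natrM natrD natrM.
by rewrite /low -[l.+1%:R]natr1; lra.
Qed.

(** From numq y * 4 = m * denq y and coprimality, denq y divides 4. *)
Lemma logn_denq_le2 (y : rat) : 4 * y \is a Num.int ->
  (logn 2 `|denq y| <= 2)%N.
Proof.
case/intrP => m y4; change (logn 2 `|denq y| <= logn 2 4)%N.
apply: dvdn_leq_log => //.
have eq_m : numq y * 4 = m * denq y.
  apply: (@intr_inj rat); rewrite !rmorphM /= -y4 numqE; ring.
have : (denq y %| numq y * 4)%Z by rewrite eq_m dvdz_mull.
by rewrite Gauss_dvdzr // coprimezE coprime_sym coprime_num_den.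
Qed.

Lemma logn_denq_quarter (n : nat) : odd n ->
  logn 2 `|denq (n%:R / 4)|%N = 2%N.
Proof.
move=> n_odd.
have -> : n%:R / 4 = (n%:Z)%:~R / (4%:Z)%:~R :> rat by [].
rewrite coprimeq_den //.
by apply: (@coprimeXr 2 n 2); rewrite coprimen2.
Qed.

Theorem corollary20 (R : rcfType) (t : nat) (t_odd : odd t) (t_ge7 : (7 <= t)%N) :
  effective_exponent t (N R t + 2)%N = 2%N.
Proof.
have t_ge2 : (2 <= t)%N by lia.
have t_ge5 : (5 <= t)%N by lia.
have [/low_le_of_u le_high _] := L_max R t_ge5.
(* N_t + 2 is the second index of block L_t + 1. *)
have NE : (N R t + 2 = t + (4 * (L R t).+1 + 1))%N by rewrite /N; lia.
rewrite /effective_exponent NE; apply/eqP; rewrite eqn_leq; apply/andP; split.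
  apply/bigmax_leqP_seq => i; rewrite mem_index_iota ltnS => /andP[le_ti le_i].
  move=> _; rewrite -(subnKC le_ti); apply: logn_denq_le2.
  by apply: (orbit_y_quarter_int t_ge2 le_high); rewrite leq_subLR.
have le_high1 : low t 1 + 1 <= t%:R ^+ 2 / 4.
  by have := low_mono t_ge2 (ltn0Sn (L R t)); lra.
have y_t2 : logn 2 `|denq (orbit_y t (t + 2))|%N = 2%N.
  by rewrite orbit_y_t2 // -natrX logn_denq_quarter // oddX t_odd orbT.
by apply: (bigmaxn_sup_seq (t + 2)%N); rewrite ?mem_index_iota ?y_t2 //; lia.
Qed.
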